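(* Let $X$ and $Y$ be infinite-dimensional real Banach spaces, and let $N$ be an absolute normalized norm on $\mathbb{R}^2$ different from the $\infty$-norm, i.e., $N(1,1)>1$. Then $X\oplus_N Y$ does not have property (P1).
   Context: A norm $N$ on $\mathbb{R}^2$ is absolute if $N(a,b)=N(|a|,|b|)$ for all $(a,b)\in\mathbb{R}^2$, and normalized if $N(1,0)=N(0,1)=1$. For Banach spaces $X,Y$ and an absolute normalized norm $N$, $X\oplus_N Y$ denotes the direct sum $X\oplus Y$ equipped with the norm $\|(x,y)\|_N=N(\|x\|,\|y\|)$. For a Banach space $Z$ with closed unit ball $B_Z$, dual $Z^\ast$ and dual unit sphere $S_{Z^\ast}$, a slice of $B_Z$ is a set of the form $S(z^\ast,\alpha)=\{z\in B_Z\colon z^\ast(z)>1-\alpha\}$ with $z^\ast\in S_{Z^\ast}$ and $\alpha>0$. A convex combination of slices of $B_Z$ is a set of the form $\sum_{i=1}^n\lambda_iS_i=\{\sum_{i=1}^n\lambda_i s_i\colon s_i\in S_i\}$, where $n\in\mathbb{N}$, $\lambda_1,\dotsc,\lambda_n\geq 0$, $\sum_{i=1}^n\lambda_i=1$, and $S_1,\dotsc,S_n$ are slices of $B_Z$. Property (P1) of a Banach space $Z$: every convex combination of slices of $B_Z$ is open in the relative weak topology of $B_Z$. *)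

(* Defs.v *)
From HB Require Import structures.
From mathcomp Require Import all_boot all_order all_algebra.
From mathcomp Require Import all_classical all_reals all_analysis.

Set Implicit Arguments.
Unset Strict Implicit.
Unset Printing Implicit Defensive.

Import Order.TTheory GRing.Theory Num.Theory.
Import numFieldNormedType.Exports.

Local Open Scope classical_set_scope.
Local Open Scope ring_scope.

Definition infinite_dimensional (R : realType) (V : lmodType R) : Prop :=
  ~ exists (n : nat) (e : 'I_n -> V),
      forall v : V, exists c : 'I_n -> R, v = \sum_(i < n) c i *: e i.

(* Nonnegativity of the norm follows from the first two fields. *)
Record abs_norm (R : realType) := AbsNorm {
  abs_norm_fun :> R -> R -> R;
  abs_normD : forall a b c d,
    abs_norm_fun (a + c) (b + d) <= abs_norm_fun a b + abs_norm_fun c d;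
  abs_normZ : forall t a b,
    abs_norm_fun (t * a) (t * b) = `|t| * abs_norm_fun a b;
  abs_norm_eq0 : forall a b, abs_norm_fun a b = 0 -> a = 0 /\ b = 0;
  abs_norm_abs : forall a b, abs_norm_fun a b = abs_norm_fun `|a| `|b|;
  abs_norm10 : abs_norm_fun 1 0 = 1;
  abs_norm01 : abs_norm_fun 0 1 = 1
}.

Definition infty_norm (R : realType) (a b : R) : R := Num.max `|a| `|b|.

Section abs_norm_theory.
Variables (R : realType) (N : abs_norm R).
Implicit Types a b c d : R.

Lemma abs_normNr a b : N a (- b) = N a b.
Proof. by rewrite abs_norm_abs normrN -abs_norm_abs. Qed.

Lemma abs_normNl a b : N (- a) b = N a b.
Proof. by rewrite abs_norm_abs normrN -abs_norm_abs. Qed.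

Lemma abs_norma0 a : N a 0 = `|a|.
Proof. by have := abs_normZ N a 1 0; rewrite mulr1 mulr0 abs_norm10 mulr1. Qed.

Lemma abs_norm0a a : N 0 a = `|a|.
Proof. by have := abs_normZ N a 0 1; rewrite mulr1 mulr0 abs_norm01 mulr1. Qed.

Lemma abs_norm_le_r a b d : 0 <= b -> b <= d -> N a b <= N a d.
Proof.
move=> b0 bd; have d0 : 0 <= d by exact: le_trans bd.
have [d_eq0|dN0] := eqVneq d 0.
  suff -> : b = d by [].
  by apply/eqP; rewrite eq_le bd d_eq0.
have dgt0 : 0 < d by rewrite lt_neqAle eq_sym dN0.
pose t := (1 + b / d) / 2.
have bd0 : 0 <= b / d by rewrite divr_ge0.
have bd1 : b / d <= 1 by rewrite ler_pdivrMr// mul1r.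
have t0 : 0 <= t by rewrite divr_ge0// addr_ge0.
have t1 : 0 <= 1 - t.
  by rewrite subr_ge0 ler_pdivrMr// mul1r -[leRHS]/(1 + 1) lerD2l.
have -> : N a b = N (t * a + (1 - t) * a) (t * d + (1 - t) * (- d)).
  congr (abs_norm_fun N _ _); first by rewrite -mulrDl addrCA subrr addr0 mul1r.
  rewrite mulrN -mulrBl opprB addrA -mulr2n -[t *+ 2]mulr_natr divfK//.
  by rewrite addrAC subrr add0r divfK.
rewrite (le_trans (abs_normD _ _ _ _ _))// !abs_normZ abs_normNr -mulrDl.
by rewrite !ger0_norm// addrCA subrr addr0 mul1r.
Qed.

Lemma abs_normC_subproof : exists M : abs_norm R, forall a b, M a b = N b a.
Proof.
unshelve eexists (@AbsNorm R (fun a b => N b a) _ _ _ _ _ _) => //.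
- by move=> *; exact: abs_normD.
- by move=> *; exact: abs_normZ.
- by move=> a b /abs_norm_eq0[].
- by move=> *; exact: abs_norm_abs.
- exact: abs_norm01.
- exact: abs_norm10.
Qed.

End abs_norm_theory.

Section abs_norm_theory2.
Variables (R : realType) (N : abs_norm R).
Implicit Types a b c d : R.

Lemma abs_norm_le a b c d :
  0 <= a -> 0 <= b -> a <= c -> b <= d -> N a b <= N c d.
Proof.
move=> a0 b0 ac bd; rewrite (le_trans (abs_norm_le_r N a b0 bd))//.
by have [M MN] := abs_normC_subproof N; rewrite -!MN; exact: abs_norm_le_r.
Qed.

Lemma infty_norm_le a b : infty_norm a b <= N a b.
Proof.
rewrite [N a b]abs_norm_abs /infty_norm ge_max; apply/andP; split.
  by rewrite (@le_trans _ _ (N `|a| 0)) ?abs_norm_le// abs_norma0 normr_id.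
by rewrite (@le_trans _ _ (N 0 `|b|)) ?abs_norm_le// abs_norm0a normr_id.
Qed.

Lemma abs_norm_le_sum a b : N a b <= `|a| + `|b|.
Proof.
by rewrite -(abs_norma0 N) -(abs_norm0a N) -{1}[a]addr0 -{1}[b]add0r abs_normD.
Qed.

Lemma neq_infty_normP : (N : R -> R -> R) <> @infty_norm R <-> 1 < N 1 1.
Proof.
split=> [Nneq|N11 NE]; last first.
  by move: N11; rewrite NE /infty_norm normr1 maxxx ltxx.
rewrite ltNge; apply/negP => N11; apply: Nneq; apply/funext => a.
apply/funext => b; apply/eqP; rewrite eq_le infty_norm_le andbT.
rewrite abs_norm_abs.
have m0 : 0 <= infty_norm a b by rewrite /infty_norm le_max normr_ge0.
rewrite (@le_trans _ _ (N (infty_norm a b * 1) (infty_norm a b * 1)))//.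
  by rewrite mulr1 abs_norm_le// /infty_norm le_max lexx ?orbT.
by rewrite abs_normZ ger0_norm// ler_piMr.
Qed.

End abs_norm_theory2.

(* The direct sum gets its own name because [X * Y] already carries the
   maximum norm. *)
Definition dsum (R : realType) (N : abs_norm R) (X Y : normedModType R) : Type :=
  (X * Y)%type.

Section dsum_normed.
Variables (R : realType) (N : abs_norm R) (X Y : normedModType R).
Local Notation Z := (dsum N X Y).

HB.instance Definition _ := GRing.Lmodule.copy Z (X * Y)%type.

Definition dsum_norm (z : Z) : R := N `|z.1| `|z.2|.

Let ler_dsum_normD (x y : Z) : dsum_norm (x + y) <= dsum_norm x + dsum_norm y.
Proof.
by rewrite (le_trans _ (abs_normD _ _ _ _ _))// abs_norm_le// ler_normD.
Qed.

Let dsum_normZ (l : R) (x : Z) : dsum_norm (l *: x) = `|l| * dsum_norm x.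
Proof. by rewrite /dsum_norm !normrZ abs_normZ normr_id. Qed.

Let dsum_norm_eq0 (x : Z) : dsum_norm x = 0 -> x = 0.
Proof. by case: x => x y /abs_norm_eq0[/normr0_eq0 /= -> /normr0_eq0 /= ->]. Qed.

HB.instance Definition _ :=
  Lmodule_isNormed.Build R Z ler_dsum_normD dsum_normZ dsum_norm_eq0.

Lemma dsum_normE (z : Z) : `|z| = N `|z.1| `|z.2|.
Proof. by []. Qed.

Lemma dsum_norm1_le (z : Z) : `|z.1| <= `|z|.
Proof.
apply: le_trans (infty_norm_le N _ _).
by rewrite /infty_norm !normr_id le_max lexx.
Qed.

Lemma dsum_norm2_le (z : Z) : `|z.2| <= `|z|.
Proof.
apply: le_trans (infty_norm_le N _ _).
by rewrite /infty_norm !normr_id le_max lexx orbT.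
Qed.

Lemma dsum_norm_le (z : Z) : `|z| <= `|z.1| + `|z.2|.
Proof. by apply: le_trans (abs_norm_le_sum N _ _) _; rewrite !normr_id. Qed.

End dsum_normed.

Section dsum_complete.
Variables (R : realType) (N : abs_norm R) (X Y : completeNormedModType R).
Local Notation Z := (dsum N X Y).

Lemma dsum_complete (F : set_system Z) : ProperFilter F -> cauchy F -> cvg F.
Proof.
move=> FF /cauchy_ballP Fc.
have cau (V : completeNormedModType R) (p : Z -> V) :
    (forall z w, `|p z - p w| <= `|z - w|) -> cvg (p @ F).
  move=> pl; apply: cauchy_cvg; apply/cauchy_ballP => e e0.
  have [[A B] /= [FA FB] AB] := Fc _ e0.
  exists (p @` A, p @` B) => /=.
    by split; [apply: filterS FA|apply: filterS FB] => z Hz; exists z.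
  move=> [_ _] /= [[z Az <-] [w Bw <-]].
  have := AB (z, w) (conj Az Bw); rewrite -!ball_normE /=.
  exact: le_lt_trans.
have /cau/cvgrPdist_lt c1 : forall z w : Z, `|z.1 - w.1| <= `|z - w|.
  by move=> z w; exact: (dsum_norm1_le (z - w)).
have /cau/cvgrPdist_lt c2 : forall z w : Z, `|z.2 - w.2| <= `|z - w|.
  by move=> z w; exact: (dsum_norm2_le (z - w)).
apply/cvg_ex; exists ((lim (fst @ F), lim (snd @ F)) : Z).
apply/fcvgrPdist_lt => e e0; near=> z.
rewrite (le_lt_trans (dsum_norm_le _))// [ltRHS]splitr ltrD//=.
  by near: z; apply: c1; rewrite divr_gt0.
by near: z; apply: c2; rewrite divr_gt0.
Unshelve. all: by end_near. Qed.

HB.instance Definition _ := Uniform_isComplete.Build Z dsum_complete.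

End dsum_complete.

Section property_P1.
Variables (R : realType) (Z : normedModType R).

Record dual := Dual {
  dual_fun :> {linear Z -> R^o};
  dual_continuous : continuous dual_fun
}.

Definition unit_ball : set Z := [set z | `|z| <= 1].

Definition dual_norm (f : dual) : R := sup [set `|f z| | z in unit_ball].

Definition dual_sphere : set dual := [set f | dual_norm f = 1].

Definition weak_topology : topologicalType :=
  sup_topology (fun f : dual => Topological.on (initial_topology (f : Z -> R^o))).

Definition slice (f : dual) (alpha : R) : set Z :=
  [set z | unit_ball z /\ 1 - alpha < f z].

Definition is_slice (S : set Z) : Prop :=
  exists f alpha, [/\ dual_sphere f, 0 < alpha & S = slice f alpha].

Definition is_convex_combination_of_slices (C : set Z) : Prop :=
  exists (n : nat) (lambda : 'I_n -> R) (S : 'I_n -> set Z),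
    [/\ forall i, 0 <= lambda i,
        \sum_(i < n) lambda i = 1,
        forall i, is_slice (S i) &
        C = [set z | exists2 s : 'I_n -> Z, forall i, S i (s i) &
                       z = \sum_(i < n) lambda i *: s i]].

Definition relatively_weakly_open (C : set Z) : Prop :=
  exists2 U : set weak_topology, open U & C = unit_ball `&` U.

End property_P1.

Definition property_P1 (R : realType) (Z : completeNormedModType R) : Prop :=
  forall C : set Z, is_convex_combination_of_slices C -> relatively_weakly_open C.

(* Main.v *)
(* For unit functionals f, g norming unit vectors x, y and a small alpha, let
   C be the set of midpoints of the slices S((f, 0), alpha) and S((0, g), alpha).
   With p = 1 - 3 alpha / 4, the points (p x, - (alpha / 2) y) and (0, p y) lie in
   these slices, so their midpoint z lies in C.  A weakly open set containing z
   contains z + s (w, 0) for all s, for some w <> 0 in the common kernel of finitely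
   many functionals.  This lets the norm of the first coordinate grow to any value a
   such that (a, b) is in the unit ball of N, where b = (1 - 5 alpha / 4) / 2 is the
   norm of the second coordinate of z.  But a point of C whose first coordinate has
   norm a needs a point (u, v) of the second slice with |u| >= 2 a - 1 and
   |v| > 1 - alpha.  Since b < (1 - alpha) / 2, convexity of N provides a with
   N(a, b) <= 1 < N(2 a - 1, 1 - alpha). *)
Require Import Defs.
From HB Require Import structures.
From mathcomp Require Import all_boot all_order all_algebra.
From mathcomp Require Import all_classical all_reals all_analysis.
From mathcomp Require Import finmap ring lra.

Set Implicit Arguments.
Unset Strict Implicit.
Unset Printing Implicit Defensive.

Import Order.TTheory GRing.Theory Num.Theory.
Import numFieldNormedType.Exports.

Local Open Scope classical_set_scope.
Local Open Scope ring_scope.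

(** * Hahn-Banach extension through graphs of linear forms *)

Section Hahn_Banach.
Variables (R : realType) (X : normedModType R).
Implicit Types (G : set (X * R)) (u v : X) (r s t : R).

Definition linear_graph G := forall t p q, G p -> G q -> G (t *: p.1 + q.1, t * p.2 + q.2).

Definition dominated_graph G := forall p, G p -> p.2 <= `|p.1|.

(** By the triangle inequality, every lower bound q.2 - |q.1 - v| required of [c] is below every
    upper bound |q.1 + v| - q.2, so the supremum of the lower bounds works. *)
Lemma dominated_extension G v : G (0, 0) -> linear_graph G -> dominated_graph G ->
  exists c, dominated_graph
    [set p | exists t, exists2 q, G q & p = (q.1 + t *: v, q.2 + t * c)].
Proof.
move=> G0 Gl Gd.
pose L := [set q.2 - `|q.1 - v| | q in G].
have Lub (q : X * R) : G q -> ubound L (`|q.1 + v| - q.2).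
  move=> Gq _ [p Gp <-].
  have := Gd _ (Gl 1 _ _ Gp Gq); rewrite /= scale1r mul1r => h.
  have : `|p.1 + q.1| <= `|p.1 - v| + `|q.1 + v|.
    by rewrite (le_trans _ (ler_normD _ _))// addrACA addNr addr0.
  lra.
have L0 : L !=set0 by exists ((0 : R) - `|0 - v|); exists (0, 0).
have cub q : G q -> q.2 - `|q.1 - v| <= sup L.
  by move=> Gq; apply: ub_le_sup; [exists (`|0 + v| - 0); exact: (Lub (0, 0))|exists q].
have clb q : G q -> sup L <= `|q.1 + v| - q.2.
  by move=> Gq; apply: ge_sup => //; exact: Lub.
exists (sup L) => _ [t [q Gq ->]] /=.
(* Homogeneity reduces nonzero [t] to -1 and 1, where the two bounds on [sup L] apply. *)
have Gs s : G (s *: q.1, s * q.2).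
  by have := Gl s _ _ Gq G0; rewrite /= !addr0.
have [t0|t0|->] := ltgtP t 0; last by rewrite scale0r mul0r !addr0; exact: Gd.
- have tN : 0 < - t by rewrite oppr_gt0.
  have := cub _ (Gs (- t)^-1); rewrite /=.
  have -> : (- t)^-1 *: q.1 - v = (- t)^-1 *: (q.1 + t *: v).
    by rewrite scalerDr scalerA invrN mulNr mulVf ?lt_eqF// scaleN1r.
  rewrite normrZ gtr0_norm ?invr_gt0// -mulrBr mulrC ler_pdivrMr//.
  nra.
- have := clb _ (Gs t^-1); rewrite /=.
  have -> : t^-1 *: q.1 + v = t^-1 *: (q.1 + t *: v).
    by rewrite scalerDr scalerA mulVf ?gt_eqF// scale1r.
  rewrite normrZ gtr0_norm ?invr_gt0// -mulrBr mulrC ler_pdivlMr//.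
  nra.
Qed.

(* Hahn-Banach, by maximizing (with Zorn) the graph of a linear form dominated
   by the norm.  Domination alone makes the graph single-valued. *)
Lemma norming_functional v0 : exists f : {linear X -> R^o},
  (forall v, `|f v| <= `|v|) /\ f v0 = `|v0|.
Proof.
pose L := [set (t *: v0, t * `|v0|) | t in setT] : set (X * R).
pose ok G := linear_graph G /\ dominated_graph G.
have Ll : ok L.
  split=> [t _ _ [r _ <-] [s _ <-]|_ [t _ <-]] /=.
    by exists (t * r + s) => //; rewrite scalerA -scalerDl mulrA -mulrDl.
  by rewrite normrZ ler_wpM2r// ler_norm.
(* Taking the union with [L] lets the empty chain, whose union is empty, satisfy the condition. *)
have [F okF Ftot|G [[Gl Gd] Gmax]] :=
    @Zorn_bigcup (X * R)%type [set G | ok (L `|` G)].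
  (* Linearity involves two points at a time, so one admissible graph containing both suffices. *)
  have dir p q : (L `|` \bigcup_(A in F) A) p -> (L `|` \bigcup_(A in F) A) q ->
      exists B, [/\ ok B, B p, B q & B `<=` L `|` \bigcup_(A in F) A].
    have sub A : F A -> L `|` A `<=` L `|` \bigcup_(A in F) A.
      by move=> FA; apply: setUS; exact: bigcup_sup.
    move=> [Lp|[A FA Ap]] [Lq|[B FB Bq]].
    - by exists L; split=> //; left.
    - by exists (L `|` B); split; [exact: okF|left|right|exact: sub].
    - by exists (L `|` A); split; [exact: okF|right|left|exact: sub].
    - have [AB|BA] := Ftot _ _ FA FB.
      + by exists (L `|` B); split; [exact: okF|right; exact: AB|right|exact: sub].
      + by exists (L `|` A); split; [exact: okF|right|right; exact: BA|exact: sub].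
  split=> [t p q|p].
    by move=> Fp Fq; have [B [[Bl _] Bp Bq]] := dir _ _ Fp Fq; apply; exact: Bl.
  by move=> Fp; have [B [[_ Bd] Bp _ _]] := dir _ _ Fp Fp; exact: Bd.
set H := L `|` G in Gl Gd.
have H0 : H (0, 0) by left; exists 0 => //; rewrite scale0r mul0r.
have Hfun v r s : H (v, r) -> H (v, s) -> r = s.
  have le r' s' : H (v, r') -> H (v, s') -> r' <= s'.
    move=> Hr Hs; have := Gd _ (Gl (-1) _ _ Hs Hr).
    by rewrite /= scaleN1r addNr normr0 mulN1r addrC subr_le0.
  by move=> Hr Hs; apply/eqP; rewrite eq_le !le.
have Htot v : exists r, H (v, r).
  have [c Bd] := dominated_extension v H0 Gl Gd.
  set B := [set _ | _] in Bd.
  have HB : H `<=` B.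
    by move=> [u r] Hu; exists 0; exists (u, r) => //; rewrite scale0r mul0r !addr0.
  have Bl : linear_graph B.
    move=> t _ _ [r [p Hp ->]] [s [q Hq ->]]; exists (t * r + s).
    exists (t *: p.1 + q.1, t * p.2 + q.2); first exact: Gl.
    congr pair => /=; last by ring.
    by rewrite scalerDr scalerA addrACA -scalerDl.
  have LB : L `|` B = B by apply/setUidPr => x Lx; apply: HB; left.
  have Bv : B (v, c) by exists 1, (0, 0) => //; rewrite scale1r mul1r !add0r.
  apply: contrapT => vH; apply: (Gmax B); last by rewrite /= LB.
  rewrite properEneq; split; last by move=> x Gx; apply: HB; right.
  by apply/eqP => GB; apply: vH; exists c; right; rewrite GB.
have [f fP] := choice Htot.
have f_lin : linear (f : X -> R^o).
  by move=> t u v; apply: (Hfun (t *: u + v)) => //; exact: (Gl t (u, f u) (v, f v)).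
pose fl := GRing.isLinear.Build R X R^o *:%R f f_lin.
pose F : {linear X -> R^o} := HB.pack f fl.
have Fle v : F v <= `|v| by exact: Gd (fP v).
exists F; split.
  by move=> v; rewrite ler_norml Fle andbT lerNl -raddfN -(normrN v) Fle.
by apply: (Hfun v0); [exact: fP|left; exists 1 => //; rewrite scale1r mul1r].
Qed.

End Hahn_Banach.

(** * Finitely many linear forms and weak neighbourhoods *)

Lemma linear_forms_finite_codim (R : realType) (V : lmodType R) (n : nat)
    (f : 'I_n -> {linear V -> R^o}) :
  exists m (e : 'I_m -> V), forall v, exists c : 'I_m -> R,
    forall i, f i (v - \sum_(j < m) c j *: e j) = 0.
Proof.
elim: n f => [|n IHn] f.
  by exists 0, (fun=> 0) => v; exists (fun=> 0) => -[].
have [m [e eP]] := IHn (f \o lift ord0).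
have [[k kP k0]|kN] := pselect
    (exists2 k, forall i, f (lift ord0 i) k = 0 & f ord0 k != 0).
- exists m.+1, (fun j => oapp e k (unlift ord0 j)) => v.
  have [c cP] := eP v; pose r := v - \sum_(j < m) c j *: e j.
  (* The new coefficient cancels [f ord0] on the residue [r]; the other forms vanish at [k]. *)
  exists (fun j => oapp c (f ord0 r / f ord0 k) (unlift ord0 j)) => i.
  rewrite big_ord_recl unlift_none /=.
  under eq_bigr do rewrite liftK /=.
  rewrite opprD addrCA -/r linearD linearN linearZ_LR.
  case: (unliftP ord0 i) => [j|] ->; last by rewrite /GRing.scale /= divfK// addNr.
  by rewrite kP scaler0 oppr0 add0r; exact: cP.
(* Here [f ord0] vanishes wherever the other forms do, so the old vectors suffice. *)
- exists m, e => v; have [c cP] := eP v; exists c => i.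
  case: (unliftP ord0 i) => [j|] ->; first exact: cP.
  by apply/eqP/negP => /negP h; apply: kN; exists (v - \sum_(j < m) c j *: e j).
Qed.

Lemma infinite_dimensional_common_kernel (R : realType) (V : lmodType R) (n : nat)
    (f : 'I_n -> {linear V -> R^o}) :
  infinite_dimensional V -> exists2 w, w != 0 & forall i, f i w = 0.
Proof.
move=> Vinf; apply: contrapT => kerN; apply: Vinf.
have [m [e eP]] := linear_forms_finite_codim f.
exists m, e => v; have [c cP] := eP v; exists c.
apply/eqP; rewrite -subr_eq0; apply/negP => /negP h.
by apply: kerN; exists (v - \sum_(i < m) c i *: e i).
Qed.

(** A basic neighbourhood is a finite intersection of preimages under functionals, so membership
    depends only on their values. *)
Lemma weak_open_finite (R : realType) (Z : normedModType R)
    (U : set (weak_topology Z)) (z : Z) : open U -> U z ->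
  exists n (g : 'I_n -> dual Z), forall z' : Z, (forall i, g i z' = g i z) -> U z'.
Proof.
move=> [B Bsub <-] [A BA Az].
have [D Dsub AE] := Bsub _ BA.
pose s := in_tuple (enum_fset D).
have sD i : exists g : dual Z, forall z' : Z, g z' = g z -> tnth s i z'.
  have Di : tnth s i \in D by exact: mem_tnth.
  have /set_mem[g _ [V _ gV]] := Dsub _ Di.
  exists g => z' gz'.
  have : tnth s i z by rewrite -AE in Az; exact: Az.
  by rewrite -gV /= gz'.
have [g gP] := choice sD.
exists (size (enum_fset D)), g => z' gz'.
suff Az' : A z' by exists A.
rewrite -AE => E /= ED.
have /tnthP[i ->] : E \in s by [].
exact: gP.
Qed.

(** * Norms along a line and the geometry of [N] *)

Lemma norm_line_reach (R : realType) (V : normedModType R) (x w : V) (a : R) :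
  w != 0 -> `|x| <= a -> exists t : R, `|x + t *: w| = a.
Proof.
move=> w0 xa; have wn : 0 < `|w| by rewrite normr_gt0.
have a0 : 0 <= a := le_trans (normr_ge0 x) xa.
(* The reverse triangle inequality gives |x + T w| >= T |w| - |x| = a. *)
pose T := (a + `|x|) / `|w|.
have T0 : 0 <= T by rewrite divr_ge0 ?addr_ge0.
have fc : continuous (fun t : R => `|x + t *: w|).
  move=> t; apply: cvg_norm; apply: cvgD; first exact: cvg_cst.
  by apply: cvgZr_tmp => //; exact: cvg_id.
have [||t _ <-] := @IVT R (fun t => `|x + t *: w|) 0 T a T0; last by exists t.
  exact: continuous_subspaceT.
rewrite scale0r addr0 ge_min xa /= le_max; apply/orP; right.
have := ler_normB (x + T *: w) x.
rewrite addrAC subrr add0r normrZ ger0_norm// divfK ?gt_eqF//.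
lra.
Qed.

(* [t] slightly exceeds the largest [t'] with [N t' (1 - alpha) <= 1].  The chord
   from [(1, 0)] to [(t', 1 - alpha)] has midpoint [((1 + t') / 2, (1 - alpha) / 2)];
   strictly below that height it goes beyond the abscissa [(1 + t) / 2]. *)
Lemma abs_norm_chord (R : realType) (N : abs_norm R) : 1 < N 1 1 ->
  exists alpha t : R, [/\ 0 < alpha < 1/2, 0 <= t, 1 < N t (1 - alpha) &
    N ((1 + t) / 2) ((1 - 5 * alpha / 4) / 2) <= 1].
Proof.
move=> N11; have N2 : N 1 1 <= 2.
  by rewrite (le_trans (abs_norm_le_sum _ _ _))// normr1.
(* This makes (1 - al) N(1, 1) = (1 - al)(1 + 4 al) > 1, which bounds [A] below by 1 - al as an
   upper bound. *)
pose al : R := (N 1 1 - 1) / 4.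
have al0 : 0 < al by rewrite /al; lra.
have al1 : al <= 1/4 by rewrite /al; lra.
have Nal : 1 < (1 - al) * N 1 1.
  have -> : N 1 1 = 1 + 4 * al by rewrite /al; field.
  nra.
pose A := [set t | 0 <= t /\ N t (1 - al) <= 1].
have Aub t : A t -> t <= 1 - al.
  move=> [t0 tA]; rewrite leNgt; apply/negP => tgt.
  have : N (1 - al) (1 - al) <= N t (1 - al) by apply: abs_norm_le; lra.
  have := abs_normZ N (1 - al) 1 1; rewrite mulr1 ger0_norm; last by lra.
  lra.
have A0 : A 0 by split => //; rewrite abs_norm0a ger0_norm; lra.
have hA : has_sup A by split; [exists 0|exists (1 - al)].
have e0 : 0 < al ^+ 2 / 8 by rewrite divr_gt0// exprn_gt0.
have [t' At' tD] := sup_adherent e0 hA.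
have D0 : 0 <= sup A by apply: ub_le_sup => //; case: hA.
exists al, (sup A + al ^+ 2 / 8); split.
- by apply/andP; split; lra.
- lra.
- rewrite ltNge; apply/negP => At.
  have : sup A + al ^+ 2 / 8 <= sup A.
    by apply: ub_le_sup; [case: hA|split=> //; lra].
  lra.
- have t'ub := Aub _ At'; have [t'0 Nt'] := At'.
  (* The height nu (1 - al) exceeds the target by al^2/8. Since t' <= 1 - al, the abscissa exceeds
     (1 + t')/2 by at least al^2/8, which covers the slack in [sup A]. *)
  pose nu : R := 1/2 - al / 8.
  have nu0 : 0 <= nu by rewrite /nu; lra.
  have nu1 : 0 <= 1 - nu by rewrite /nu; lra.
  apply: (@le_trans _ _ (N ((1 - nu) * 1 + nu * t') ((1 - nu) * 0 + nu * (1 - al)))).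
    by apply: abs_norm_le; rewrite ?/nu; nra.
  rewrite (le_trans (abs_normD _ _ _ _ _))// !abs_normZ abs_norm10 !ger0_norm//.
  nra.
Qed.

(** * Functionals and slices in the direct sum *)

Lemma norming_dual (R : realType) (Z V : normedModType R) (p : Z -> V) (v : V) (z0 : Z) :
  linear p -> (forall z, `|p z| <= `|z|) -> `|v| = 1 -> `|z0| <= 1 -> p z0 = v ->
  exists d : dual Z, [/\ dual_sphere d, forall z, d z <= `|p z| &
                         forall t z, p z = t *: v -> d z = t].
Proof.
move=> plin ple v1 z01 pz0; have [f [fle fv]] := norming_functional v.
have glin : linear ((fun z => f (p z)) : Z -> R^o).
  by move=> t a b; rewrite plin linearP.
pose gmix := GRing.isLinear.Build R Z R^o *:%R _ glin.
pose g : {linear Z -> R^o} := HB.pack (fun z : Z => f (p z)) gmix.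
have gle z : `|g z| <= `|z| by exact: le_trans (fle _) (ple z).
have gc : continuous g.
  apply: bounded_linear_continuous; apply/linear_boundedP.
  by near=> r => z; rewrite (le_trans (gle z))// ler_peMl.
have gz0 : g z0 = 1 by rewrite /g /= pz0 fv.
exists (Dual gc); split.
- rewrite /dual_sphere /= /dual_norm.
  have ub1 : ubound [set `|g z| | z in @unit_ball R Z] 1.
    by move=> _ [z z1 <-]; exact: le_trans (gle z) z1.
  have mem1 : [set `|g z| | z in @unit_ball R Z] 1 by exists z0 => //; rewrite gz0 normr1.
  apply/eqP; rewrite eq_le ge_sup//=; last by exists 1.
  by apply: ub_le_sup => //; exists 1.
- by move=> z; exact: le_trans (ler_norm _) (fle _).
- by move=> t z pz; rewrite /= pz linearZ_LR fv v1 /GRing.scale /= mulr1.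
Unshelve. all: by end_near. Qed.

Lemma infinite_dimensional_unit (R : realType) (V : normedModType R) :
  infinite_dimensional V -> exists v : V, `|v| = 1.
Proof.
(* For the empty family of forms the lemma just yields a nonzero vector. *)
move=> /(@infinite_dimensional_common_kernel _ _ 0 (fun=> \0)%R)[w w0 _].
by exists (`|w|^-1 *: w); rewrite normrZ normfV normr_id mulVf// normr_eq0.
Qed.

Lemma dsum_inl_linear (R : realType) (N : abs_norm R) (X Y : normedModType R)
    (f : dual (dsum N X Y)) : linear ((fun x => f (x, 0)) : X -> R^o).
Proof.
move=> t u v; rewrite -linearP; congr (f _).
by congr pair; rewrite /= scaler0 addr0.
Qed.

Lemma slice_midpoint (R : realType) (Z : normedModType R) (f g : dual Z) (alpha : R) :
  dual_sphere f -> dual_sphere g -> 0 < alpha ->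
  is_convex_combination_of_slices
    [set z | exists u v, [/\ slice f alpha u, slice g alpha v & z = 2^-1 *: (u + v)]].
Proof.
move=> f1 g1 a0.
exists 2%N, (fun=> 2^-1), (fun i => slice (if i == ord0 then f else g) alpha); split.
- by move=> i; rewrite invr_ge0.
- by rewrite big_ord_recl big_ord1; lra.
- move=> i; exists (if i == ord0 then f else g), alpha; split=> //.
  by case: ifP.
- apply/seteqP; split=> [z [u [v [fu gv ->]]]|z [s sP ->]].
    exists (fun i => if i == ord0 then u else v); first by move=> i; case: ifP.
    by rewrite big_ord_recl big_ord1 /= scalerDr.
  exists (s ord0), (s (lift ord0 ord0)); split; first exact: (sP ord0).
    exact: (sP (lift ord0 ord0)).
  by rewrite big_ord_recl big_ord1 scalerDr.
Qed.

Theorem proposition2p1 (R : realType) (X Y : completeNormedModType R)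
    (N : abs_norm R) :
  infinite_dimensional X -> infinite_dimensional Y ->
  (N : R -> R -> R) <> @infty_norm R ->
  ~ property_P1 (dsum N X Y).
Proof.
move=> Xinf Yinf /neq_infty_normP/abs_norm_chord[al [t [/andP[al0 al1] t0 Nt Nab]]] P1.
have [x x1] := infinite_dimensional_unit Xinf.
have [y y1] := infinite_dimensional_unit Yinf.
have [f [f1 _ fx]] : exists f : dual (dsum N X Y), [/\ dual_sphere f,
    forall z, f z <= `|z.1| & forall t z, z.1 = t *: x -> f z = t].
  apply: (@norming_dual _ (dsum N X Y) X fst x (x, 0)) => //.
    exact: dsum_norm1_le.
  by rewrite dsum_normE /= x1 normr0 abs_norm10.
have [g [g1 gle gy]] : exists g : dual (dsum N X Y), [/\ dual_sphere g,
    forall z, g z <= `|z.2| & forall t z, z.2 = t *: y -> g z = t].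
  apply: (@norming_dual _ (dsum N X Y) Y snd y (0, y)) => //.
    exact: dsum_norm2_le.
  by rewrite dsum_normE /= y1 normr0 abs_norm01.
have [U Uo CE] := P1 _ (slice_midpoint f1 g1 al0).
pose p : R := 1 - 3 * al / 4.
(* The negative second coordinate lowers the midpoint's height to (p - al/2)/2, while the norm stays
   at most p + al/2 = 1 - al/4. *)
pose u : dsum N X Y := (p *: x, - (al / 2) *: y).
pose v : dsum N X Y := (0, p *: y).
have Cz : (@unit_ball R (dsum N X Y) `&` U) (2^-1 *: (u + v)).
  rewrite -CE; exists u, v; split=> //; split.
  - rewrite /unit_ball /= (le_trans (dsum_norm_le _))//= !normrZ x1 y1 !mulr1 normrN.
    by rewrite !ger0_norm /p; lra.
  - by rewrite (fx p)// /p; lra.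
  - rewrite /unit_ball /= dsum_normE /= normr0 abs_norm0a normr_id normrZ y1 mulr1.
    by rewrite ger0_norm /p; lra.
  - by rewrite (gy p)// /p; lra.
have [n [h hU]] := weak_open_finite Uo Cz.2.
pose hl i := GRing.isLinear.Build R X R^o *:%R _ (dsum_inl_linear (h i)).
pose k i : {linear X -> R^o} := HB.pack (fun x : X => h i (x, 0)) (hl i).
have [w w0 kw] := @infinite_dimensional_common_kernel _ _ _ k Xinf.
(* The target norm a is (1 + t)/2, so that t = 2 a - 1. *)
have xa : `|(p / 2) *: x| <= (1 + t) / 2.
  by rewrite normrZ x1 mulr1 ger0_norm /p; lra.
have [s xs] := norm_line_reach w0 xa.
pose z : dsum N X Y := ((p / 2) *: x + s *: w, ((1 - 5 * al / 4) / 2) *: y).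
have zE : z = 2^-1 *: (u + v) + s *: (w, 0).
  congr pair => /=; first by rewrite addr0 scalerA mulrC.
  rewrite scaler0 addr0 -scalerDl scalerA; congr (_ *: _); rewrite /p; lra.
have : (@unit_ball R (dsum N X Y) `&` U) z.
  split.
    by rewrite /unit_ball /= dsum_normE /= xs normrZ y1 mulr1 ger0_norm//; lra.
  apply: hU => i; rewrite zE linearD [X in _ + X]linearZ_LR.
  by have -> : h i (w, 0) = 0 := kw i; rewrite scaler0 addr0.
rewrite -CE => -[u' [v' [[u'1 _] [v'1 gv'] zuv]]].
have : t <= `|v'.1|.
  have : `|z.1| <= 2^-1 * (`|u'.1| + `|v'.1|).
    by rewrite zuv /= normrZ ger0_norm ?invr_ge0// ler_wpM2l ?invr_ge0// ler_normD.
  rewrite /= xs; have := le_trans (dsum_norm1_le u') u'1; lra.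
move=> tv; have := v'1; rewrite /unit_ball /= dsum_normE.
have : N t (1 - al) <= N `|v'.1| `|v'.2|.
  apply: abs_norm_le => //; first by lra.
  by have := gle v'; lra.
lra.
Qed.
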